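(* Let $M$ be a positive integer and let $d_1,\dots,d_{4M-3}$ be any integers with $1\le d_n<M$ for all $n$. Then there exist complex subspaces $W_1,\dots,W_{4M-3}$ of $\mathbb{C}^M$ with $\dim_{\mathbb{C}} W_n=d_n$ for every $n=1,\dots,4M-3$ such that $\{W_n\}_{n=1}^{4M-3}$ allows phase retrieval in $\mathbb{C}^M$.
   Context: Given subspaces $\{W_n\}_{n=1}^N$ of $\mathbb{C}^M$ with orthogonal projections $P_n:\mathbb{C}^M\to W_n$, one says that $\{W_n\}_{n=1}^N$ allows phase retrieval in $\mathbb{C}^M$ if every $x\in\mathbb{C}^M$ is determined up to a global phase factor by the measurements $\{\|P_nx\|\}_{n=1}^N$; that is, whenever $x,y\in\mathbb{C}^M$ satisfy $\|P_nx\|=\|P_ny\|$ for all $n$, there is $c\in\mathbb{C}$ with $|c|=1$ and $x=cy$. *)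

(* Defs.v *)
From mathcomp Require Import all_boot all_order all_algebra.
From mathcomp Require Import complex reals.

Set Implicit Arguments.
Unset Strict Implicit.
Unset Printing Implicit Defensive.

Import Order.TTheory GRing.Theory Num.Theory.
Local Open Scope ring_scope.

(* C^M is the space of row vectors 'rV[R[i]]_M, with R the real numbers.
   dotmx is the standard Hermitian inner product
     dotmx u v = \sum_i u_i * (v_i)^*,
   so the norms below are (real, nonnegative) elements of R[i]. *)

Definition l2norm (R : realType) (M : nat) (x : 'rV[R[i]]_M) : R[i] :=
  sqrtC (dotmx x x).

Lemma l2normE (R : realType) M (x : 'rV[R[i]]_M) : l2norm x = sqrtC (\sum_i `|x 0 i| ^+ 2).
Proof.
rewrite /l2norm dotmxE !mxE; congr sqrtC; apply: eq_bigr => i _; by rewrite !mxE normCK. Qed.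

(* The projection onto W along its orthogonal complement for dotmx. *)
Definition orthproj (R : realType) (M : nat) (W : {vspace 'rV[R[i]]_M}) :
    'End('rV[R[i]]_M) :=
  daddv_pi W (orthov (@dotmx R[i] M) W).

Lemma orthprojP (R : realType) M (W : {vspace 'rV[R[i]]_M}) x :
  orthproj W x \in W /\ forall w, w \in W -> dotmx (x - orthproj W x) w = 0.
Proof.
have dis : (W :&: orthov (@dotmx R[i] M) W = 0)%VS.
  apply/eqP; rewrite -subv0; apply/subvP=> v /memv_capP[vW /mem_orthovP/(_ v vW) v0].
  rewrite memv0; apply/negPn/negP => /dotmx_is_dotmx; by rewrite v0 ltxx.
split; first exact: memv_pi.
have full : x \in (W + orthov (@dotmx R[i] M) W)%VS.
  pose B := \matrix_(i < \dim W) (vbasis W)`_i.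
  rewrite -(subrK (x *m proj_ortho B) x) addrC; apply: memv_add.
    have /submxP[D ->] := proj_ortho_sub B x.
    rewrite mulmx_sum_row; apply: memv_suml => i _; apply: memvZ.
    by rewrite rowK vbasis_mem // mem_nth // size_tuple.
  apply/mem_orthovP => w wW; have := proj_ortho_compl_sub B x.
  move=> /orthomx1P H.
  have -> : w = (\row_i coord (vbasis W) i w) *m B.
    rewrite {1}(coord_vbasis wW) mulmx_sum_row; apply: eq_bigr => i _.
    by rewrite mxE rowK.
  by rewrite -[LHS]/(dotmx _ _) dotmxE trmx_mul map_mxM mulmxA H mul0mx mxE.
have E := daddv_pi_add dis full.
move=> w wW. rewrite /orthproj -{1}E addrAC subrr add0r.
by have /mem_orthovP := memv_pi (orthov (@dotmx R[i] M) W) W x; apply.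
Qed.

Definition allows_phase_retrieval (R : realType) (M N : nat)
    (W : 'I_N -> {vspace 'rV[R[i]]_M}) : Prop :=
  forall x y : 'rV[R[i]]_M,
    (forall n : 'I_N, l2norm (orthproj (W n) x) = l2norm (orthproj (W n) y)) ->
    exists c : R[i], `|c| = 1 /\ x = c *: y.

(* Main.v *)
Require Import Defs.
From mathcomp Require Import all_boot all_order all_algebra.
From mathcomp Require Import complex reals boolp.
From mathcomp Require Import zify ring lra.

(** Write [u = x + y] and [v = x - y]. For a Hermitian projection [P],
    [2 (|Px|^2 - |Py|^2)] is the pairing of [P] with the Hermitian matrix
    [Q = u v^* + v u^*], which is zero exactly when [x] and [y] differ by a phase.
    So phase retrieval says that no nonzero [Q] of this form is orthogonal to all
    the projections ([phase_retrieval_criterion]). Up to a nonzero factor, [Q] is unchanged by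
    [(u, v) -> (l u, conj(l)^-1 v)], by [v -> v + i s u] with [s] real, and by real
    rescaling of [v]; hence one may assume [u_i = 1] and [v_i = 0] or [1] for some
    [i] ([normalize_polarization]). The other coordinates of [u] and [v] and
    their conjugates are [4 (M - 1)] quantities, one fewer than the number of
    subspaces, and [Q] is polynomial in them. So there is room to avoid all [Q],
    by a dimension count that is made finite as follows.

    The [n]-th subspace is taken from a sequence with projections
    [P_j = D(z_j) p D(z_j)^-1], where [p] is a fixed real projection of rank
    [d_n] without zero entries, the [z_j] are distinct points of the unit circle
    and [D(z)] is diagonal with entries [z ^ (2 ^ a)]. The pairing of [P_j] with
    [Q] is a Laurent polynomial in [z_j] in which each off-diagonal entry
    of [Q] has a monomial of its own, since differences of distinct powers of two
    determine both powers. If [Q] is not diagonal, it is therefore orthogonal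
    to at most [e] of the [P_j], with [e] depending on [M] only
    ([laurent_zeros]).

    Restrict [j] to [K] values. For a given [Q], record for which pairs
    [(n, j)] the pairing vanishes. The number of zero patterns of [s]
    polynomials of bounded degree in [l] variables is [O(s ^ l)]
    ([card_zero_patterns]), so at most [O(K ^ (4 M - 4))] patterns occur, and each
    of them spoils at most [e ^ (4 M - 3)] ways of choosing one [j] for each
    [n]. As there are [K ^ (4 M - 3)] choices, a good one exists for large [K]
    ([exists_transversal]).

    A diagonal [Q] has at most two nonzero entries; its pairing with [P_j] sees
    only the diagonal of [p]. These are excluded by taking [p] with strictly
    decreasing diagonal for the first subspace and strictly increasing diagonal
    for the second one ([diagonal_polarization],
    [exists_decreasing_projection]). *)

Set Implicit Arguments.
Unset Strict Implicit.
Unset Printing Implicit Defensive.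
Import Order.TTheory GRing.Theory Num.Theory.
Local Open Scope complex_scope.
Local Open Scope sesquilinear_scope.
Local Open Scope ring_scope.
Local Notation "z ^*" := (Num.conj z) : ring_scope.

(** * Zero patterns of polynomials *)

Section ZeroPatterns.
Variables (F : fieldType) (L : finType).
Implicit Types (f g : (L -> F) -> F) (k : nat).

(** Polynomial functions of degree at most [k] in each variable. They form a
    space of dimension at most [(k + 1) ^ #|L|], which is all that the count of
    zero patterns needs; the degree in each variable makes the exponents a
    finite function type. *)
Definition multideg_le k f := exists c : {ffun L -> 'I_k.+1} -> F,
  forall q, f q = \sum_e c e * \prod_l q l ^+ e l.

Lemma multideg_le_monomial k (e : L -> nat) :
  (forall l, e l <= k)%N -> multideg_le k (fun q => \prod_l q l ^+ e l).
Proof.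
move=> ek; pose e0 : {ffun L -> 'I_k.+1} := [ffun l => inord (e l)].
exists (fun e' => (e' == e0)%:R) => q.
rewrite (bigD1 e0) //= eqxx mul1r [X in _ + X]big1 ?addr0.
  by apply: eq_bigr => l _; rewrite ffunE inordK // ltnS.
by move=> e' /negPf ->; rewrite mul0r.
Qed.

Lemma multideg_le_ext k f g : f =1 g -> multideg_le k f -> multideg_le k g.
Proof. by move=> fg [c cE]; exists c => q; rewrite -fg. Qed.

Lemma multideg_le_sum k (I : finType) (f : I -> (L -> F) -> F) :
  (forall i, multideg_le k (f i)) -> multideg_le k (fun q => \sum_i f i q).
Proof.
move=> /fin_all_exists[c cE]; exists (fun e => \sum_i c i e) => q.
under eq_bigr do rewrite cE.
by rewrite exchange_big; apply: eq_bigr => e _; rewrite mulr_suml.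
Qed.

Lemma multideg_leZ k a f : multideg_le k f -> multideg_le k (fun q => a * f q).
Proof.
move=> [c cE]; exists (fun e => a * c e) => q.
by rewrite cE mulr_sumr; apply: eq_bigr => e _; rewrite mulrA.
Qed.

Lemma multideg_leD k f g : multideg_le k f -> multideg_le k g -> multideg_le k (fun q => f q + g q).
Proof.
move=> hf hg; apply: (@multideg_le_ext _ (fun q => \sum_(b : bool) (if b then f else g) q)).
  by move=> q; rewrite big_bool.
by apply: multideg_le_sum; case.
Qed.

Lemma multideg_leM k k' f g :
  multideg_le k f -> multideg_le k' g -> multideg_le (k + k') (fun q => f q * g q).
Proof.
move=> [c cE] [c' cE'].
apply: (@multideg_le_ext _ (fun q => \sum_e \sum_e' (c e * c' e') *
           \prod_l q l ^+ (e l + e' l))).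
  move=> q; rewrite cE cE' big_distrl /=; apply: eq_bigr => e _.
  rewrite big_distrr /=; apply: eq_bigr => e' _.
  rewrite mulrACA -big_split /=; congr (_ * _).
  by apply: eq_bigr => l _; rewrite exprD.
apply: multideg_le_sum => e; apply: multideg_le_sum => e'; apply: multideg_leZ.
by apply: multideg_le_monomial => l; rewrite leq_add // -ltnS.
Qed.

Lemma multideg_le_const k a : multideg_le k (fun=> a).
Proof.
apply: (@multideg_le_ext _ (fun q => a * \prod_l q l ^+ 0)).
  by move=> q; rewrite big1 ?mulr1.
by apply: multideg_leZ; apply: multideg_le_monomial.
Qed.

Lemma multideg_le_var k l : multideg_le k.+1 (fun q => q l).
Proof.
apply: (@multideg_le_ext _ (fun q => \prod_l' q l' ^+ (l' == l))).
  move=> q; rewrite (bigD1 l) //= eqxx expr1 big1 ?mulr1 // => l' /negPf ->.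
  by rewrite expr0.
by apply: multideg_le_monomial => l'; case: (_ == _).
Qed.

Lemma multideg_le_leq k k' f : (k <= k')%N -> multideg_le k f -> multideg_le k' f.
Proof.
move=> kk' hf; rewrite -(subnKC kk').
apply: (@multideg_le_ext _ (fun q => f q * 1)) => [q|]; first exact: mulr1.
exact: multideg_leM hf (multideg_le_const _ _).
Qed.

Lemma multideg_le_prod k (I : Type) (s : seq I) (f : I -> (L -> F) -> F) :
  (forall i, multideg_le k (f i)) -> multideg_le (k * size s) (fun q => \prod_(i <- s) f i q).
Proof.
move=> hf; elim: s => [|i s IHs] /=.
  by apply: multideg_le_ext (multideg_le_const _ 1) => q; rewrite big_nil.
rewrite mulnS; apply: multideg_le_ext (multideg_leM (hf i) IHs) => q.
by rewrite big_cons.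
Qed.

(** The bound of Ronyai, Babai and Ganapathy. For a pattern [A] realised at [q_A],
    let [g_A] be the product of the [f_i] with [i] outside [A]. Then
    [g_A (q_B) != 0] exactly when [B] is contained in [A], so the matrix of these
    values is triangular for inclusion and the [g_A] are linearly independent
    in a space of polynomials of bounded degree. *)
Lemma card_zero_patterns (I : finType) k (f : I -> (L -> F) -> F)
    (Z : {set {set I}}) :
  (forall i, multideg_le k (f i)) ->
  (forall A, A \in Z -> exists q, forall i, (i \in A) = (f i q == 0)) ->
  (#|Z| <= (k * #|I|).+1 ^ #|L|)%N.
Proof.
move=> hf hZ.
have /fin_all_exists[q qE] (A : {set I}) :
    exists q, A \in Z -> forall i, (i \in A) = (f i q == 0).
  by have [/hZ[q qE]|] := boolP (A \in Z); [exists q | exists (fun=> 0)].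
have hprod (A : {set I}) :
    multideg_le (k * #|I|) (fun q => \prod_(i in ~: A) f i q).
  apply: (multideg_le_leq _ (multideg_le_ext _ (multideg_le_prod (enum (~: A)) hf))).
    by rewrite leq_mul // -cardE max_card.
  by move=> q'; rewrite big_enum.
have /fin_all_exists[c cE] := hprod.
pose val i : {set I} := enum_val (i : 'I_#|Z|).
(* the entry (A, B) is g_A (q_B) *)
pose G := \matrix_(i, j) \prod_(x in ~: val i) f x (q (val j)).
have Gneq0 i j : (G i j != 0) = (val j \subset val i).
  rewrite mxE prodf_seq_neq0; apply/allP/subsetP => [H x xj|H x _].
    have := H x (mem_index_enum _); rewrite inE -qE ?enum_valP // xj.
    by case: (x \in val i).
  by rewrite inE -qE ?enum_valP //; apply/implyP; apply: contra => /H.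
have Gfree : row_free G.
  rewrite -kermx_eq0; apply/rowV0P => a /sub_kermxP aG.
  apply/eqP; apply: contraT => /rV0Pn[i0 ai0].
  (* a maximal pattern in the support of the relation isolates its coefficient *)
  have [i ai imax] := @arg_maxnP _ i0 (fun i => a 0 i != 0) (fun i => #|val i|) ai0.
  have := congr1 (fun r : 'rV_#|Z| => r 0 i) aG; rewrite !mxE (bigD1 i) //= big1 ?addr0.
    by move/eqP; rewrite mulf_eq0 (negPf ai) -[_ == 0]negbK Gneq0 subxx.
  move=> j ji; apply/eqP; apply: contraT; rewrite mulf_eq0 negb_or => /andP[aj].
  rewrite Gneq0 => sub; have : val i == val j by rewrite eqEcard sub; apply: imax.
  by move=> /eqP /enum_val_inj ij; rewrite ij eqxx in ji.
(* expanding g_A in monomials factors G through the space of coefficients *)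
pose E := {ffun L -> 'I_(k * #|I|).+1}; pose D := #|{: E}|.
have -> : ((k * #|I|).+1 ^ #|L|)%N = D by rewrite /D card_ffun card_ord.
pose C : 'M_(#|Z|, D) := \matrix_(i, e) c (val i) (enum_val e : E).
pose Phi : 'M_(D, #|Z|) := \matrix_(e, j) \prod_l q (val j) l ^+ (enum_val e : E) l.
have GE : G = C *m Phi.
  apply/matrixP => i j; rewrite !mxE cE (reindex (enum_val : 'I_D -> E)) /=.
    by apply: eq_bigr => e _; rewrite !mxE.
  by apply/onW_bij/enum_val_bij.
by rewrite -(eqP Gfree) GE (leq_trans (mxrankM_maxl _ _)) // rank_leq_col.
Qed.
End ZeroPatterns.

(** Choosing one index for each of [N] sequences so as to avoid every bad point.
    Bad points form finitely many families, indexed by [T], each with fewer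
    than [N] parameters. With [K] candidate indices per sequence there are
    [O(K ^ #|L|)] zero patterns, each of them compatible with at most [e ^ N]
    of the [K ^ N] choices. *)
Lemma exists_transversal (F : fieldType) (L T : finType) (N k e : nat)
    (f : T -> 'I_N -> nat -> (L -> F) -> F) (X : T -> (L -> F) -> Prop) :
  (#|L| < N)%N ->
  (forall t n j, multideg_le k (f t n j)) ->
  (forall t q n s, X t q -> uniq s -> all (fun j => f t n j q == 0) s ->
     (size s <= e)%N) ->
  exists tau : 'I_N -> nat,
    forall t q, X t q -> exists n, f t n (tau n) q != 0.
Proof.
move=> LN hf hX; apply: contrapT => nogood.
(* one more than what makes the count of spoiled choices (K - 1) * K ^ #|L| *)
pose K := (#|T| * (k * N).+1 ^ #|L| * e ^ N).+1.
have /fin_all_exists2[t /fin_all_exists[q hq] _] (tau : {ffun 'I_N -> 'I_K}) :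
    exists2 t, exists q, X t q /\ forall n, f t n (tau n) q = 0 & true.
  apply: contrapT => bad; case: nogood; exists (fun n => tau n) => t q Xtq.
  apply: contrapT => nz; case: bad; exists t => //; exists q; split=> // n.
  by apply/eqP; apply: contrapT => /negP nz'; apply: nz; exists n.
pose A tau := [set x : 'I_N * 'I_K | f (t tau) x.1 x.2 (q tau) == 0].
pose Z u := [set A tau | tau in [pred tau | t tau == u]].
have cardZ u : (#|Z u| <= ((k * N).+1 * K) ^ #|L|)%N.
  apply: leq_trans (_ : ((k * #|{: 'I_N * 'I_K}|).+1 ^ #|L|)%N <= _)%N.
    apply: (card_zero_patterns (f := fun x : 'I_N * 'I_K => f u x.1 x.2)) => [x|B]; first exact: hf.
    case/imsetP=> tau /eqP tu ->; exists (q tau) => x.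
    by rewrite inE tu.
  rewrite card_prod !card_ord; case: (#|L|) => [//|l]; rewrite leq_exp2r //; rewrite /K; nia.
have cardA u (B : {set 'I_N * 'I_K}) n : B \in Z u -> (\sum_j ((n, j) \in B) <= e)%N.
  case/imsetP=> tau /eqP tu ->; rewrite -big_mkcond /= sum1_card.
  rewrite cardE -(size_map val); apply: (hX _ (q tau) n) (hq tau).1 _ _.
    by rewrite map_inj_uniq ?enum_uniq //; apply: val_inj.
  apply/allP => z /mapP[j jA ->].
  have jA' : (n, j) \in A tau by rewrite mem_enum in jA.
  by rewrite inE in jA'.
have : (#|{: {ffun 'I_N -> 'I_K}}| <= #|T| * ((k * N).+1 * K) ^ #|L| * e ^ N)%N.
  rewrite -sum1_card.
  (* each choice is spoiled by the pattern of its own witness *)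
  apply: (@leq_trans (\sum_(tau : {ffun 'I_N -> 'I_K}) \sum_u \sum_(B in Z u)
            \prod_n ((n, tau n) \in B))).
    apply: leq_sum => tau _; rewrite (bigD1 (t tau)) //= (bigD1 (A tau)) /=.
      rewrite big1 // => n _; rewrite inE /= (hq tau).2 eqxx //.
    by apply: imset_f; rewrite inE.
  rewrite exchange_big /=.
  rewrite -mulnA -sum_nat_const; apply: leq_sum => u _.
  rewrite exchange_big /=.
  apply: leq_trans (_ : #|Z u| * e ^ N <= _)%N; last by rewrite leq_mul2r cardZ orbT.
  rewrite -sum_nat_const; apply: leq_sum => B BZ.
  rewrite -(bigA_distr_bigA (fun n j => ((n, j) \in B) : nat)) /=.
  rewrite -[X in (_ <= _ ^ X)%N](card_ord N) -prod_nat_const.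
  by apply: leq_prod => n _; apply: cardA BZ.
rewrite card_ffun !card_ord expnMn => H.
have : (K ^ #|L|.+1 <= K ^ N)%N by rewrite leq_pexp2l.
move/leq_trans/(_ H); rewrite expnS.
suff -> : (#|T| * ((k * N).+1 ^ #|L| * K ^ #|L|) * e ^ N = K.-1 * K ^ #|L|)%N.
  by rewrite leq_pmul2r ?expn_gt0 // ltnn.
by rewrite /K /=; ring.
Qed.

(** * Real projections with monotone diagonal *)

(** [H] is the reflection in the hyperplane orthogonal to [v], so it is orthogonal
    and symmetric; conjugating a coordinate projection by it gives entries that
    are explicit in [v]. *)
Lemma householder_projection (R : realFieldType) (M d : nat) (v : 'rV[R]_M) (t : R) :
  t * \sum_a v 0 a ^+ 2 = 2 ->
  let H := 1%:M - t *: (v^T *m v) in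
  H *m H^T = 1%:M /\
  forall a b, (H *m pid_mx d *m H^T) a b =
    ((a == b) && (a < d)%N)%:R -
    t * v 0 a * v 0 b *
      ((a < d)%:R + (b < d)%:R - t * \sum_(c < M | (c < d)%N) v 0 c ^+ 2).
Proof.
move=> tS H; have HT : H^T = H.
  by rewrite /H !linearB /= linearZ /= trmx1 trmx_mul trmxK.
pose w : 'rV[R]_M := v *m pid_mx d.
have wE b : w 0 b = v 0 b * (b < d)%:R.
  rewrite mxE (bigD1 b) //= big1 ?addr0; first by rewrite mxE eqxx.
  by move=> c cb; rewrite mxE (_ : (c == b :> nat) = false) ?mulr0 //; apply/negbTE.
have vv : v *m v^T = (\sum_a v 0 a ^+ 2)%:M.
  apply/matrixP => i j; rewrite !ord1 !mxE mulr1n.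
  by apply: eq_bigr => a _; rewrite !mxE expr2.
have wv : w *m v^T = (\sum_(c < M | (c < d)%N) v 0 c ^+ 2)%:M.
  apply/matrixP => i j; rewrite !ord1 !mxE mulr1n [RHS]big_mkcond /=.
  apply: eq_bigr => a _; rewrite wE !mxE expr2.
  by case: (a < d)%N; rewrite ?mulr1 // mulr0 mul0r.
have Ev : pid_mx d *m v^T = w^T by rewrite trmx_mul tr_pid_mx.
rewrite HT; split.
  have VV : (v^T *m v) *m (v^T *m v) = (\sum_a v 0 a ^+ 2) *: (v^T *m v).
    by rewrite mulmxA -(mulmxA v^T) vv mul_mx_scalar -scalemxAl.
  rewrite /H mulmxBl mul1mx mulmxBr mulmx1 -scalemxAl -scalemxAr VV.
  apply/matrixP => i j; rewrite !mxE; move: (\sum_a _ ^+ 2) tS => S tS.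
  by rewrite (mulrA t S) tS; ring.
move=> a b.
have -> : H *m pid_mx d *m H = pid_mx d - t *: (v^T *m w) - t *: (w^T *m v)
    + (t * (t * \sum_(c < M | (c < d)%N) v 0 c ^+ 2)) *: (v^T *m v).
  have VEV : v^T *m v *m pid_mx d *m (v^T *m v)
      = (\sum_(c < M | (c < d)%N) v 0 c ^+ 2) *: (v^T *m v).
    by rewrite -(mulmxA v^T) -/w mulmxA -(mulmxA v^T) wv mul_mx_scalar -scalemxAl.
  rewrite /H mulmxBl mul1mx mulmxBr mulmx1 -!scalemxAl -scalemxAr mulmxBl.
  rewrite -scalemxAl VEV mulmxA Ev -(mulmxA v^T) -/w.
  by apply/matrixP => i j; rewrite !mxE; ring.
clearbody w; rewrite !mxE !big_ord1 !mxE !wE.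
by rewrite (_ : (a == b :> nat) = (a == b)) //; ring.
Qed.

(** A reflected coordinate projection. With [w = 2 s / S], where [S] is the sum of
    all [v_a ^ 2] and [s] the sum over [a < d], the diagonal entry is
    [1 - x_a (2 - w)] for [a < d] and [w x_a] otherwise, with
    [x_a = 2 v_a ^ 2 / S]. It decreases when [v] increases on the first [d]
    coordinates and decreases on the others, provided that [w] is small; this
    is arranged by making the last coordinates of [v] much larger than the
    first ones. *)
Lemma exists_decreasing_projection (R : realFieldType) (M d : nat) :
  (0 < d < M)%N -> exists H : 'M[R]_M, H *m H^T = 1%:M /\
    let p := H *m pid_mx d *m H^T in
    [/\ forall a b, a != b -> p a b != 0, forall a, 0 < p a a &
        forall a b : 'I_M, (a < b)%N -> p b b < p a a].
Proof.
move=> /andP[d0 dM].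
pose u (a : 'I_M) := (if (a < d) then a.+1 else (8 * M ^ 3 + (M - a)))%N.
pose S := (\sum_a u a ^ 2)%N.
pose s := (\sum_(a < M | (a < d)) u a ^ 2)%N.
have u_le_S a : (u a ^ 2 <= S)%N by rewrite /S (bigD1 a) //= leq_addr.
have u_le_s (a : 'I_M) : (a < d)%N -> (u a ^ 2 <= s)%N.
  by move=> ad; rewrite /s (bigD1 a) //= leq_addr.
have u_gt0 (a : 'I_M) : (0 < u a)%N by rewrite /u; case: ifP => [//|_]; have := ltn_ord a; lia.
have s_gt0 : (0 < s)%N.
  apply: leq_trans (u_le_s (Ordinal (ltn_trans d0 dM)) d0).
  by rewrite expn_gt0 u_gt0.
have sS : (8 * s < S)%N.
  have : (s <= M ^ 3)%N.
    rewrite expnS -[X in (X * _)%N]card_ord -sum_nat_const /s big_mkcond.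
    apply: leq_sum => a _; case: ifP => // ad.
    by rewrite leq_exp2r // /u ad.
  have := u_le_S (Ordinal dM); rewrite /u /= ltnn => h1 h2.
  by apply: leq_trans h1; nia.
pose v : 'rV[R]_M := \row_a (u a)%:R.
pose t : R := 2 / S%:R.
have S0 : 0 < S%:R :> R by rewrite ltr0n; lia.
have vS : \sum_a v 0 a ^+ 2 = S%:R.
  by rewrite natr_sum; apply: eq_bigr => a _; rewrite mxE natrX.
have vs : \sum_(c < M | (c < d)%N) v 0 c ^+ 2 = s%:R.
  by rewrite natr_sum; apply: eq_bigr => a _; rewrite mxE natrX.
have tS : t * S%:R = 2 by rewrite divfK ?gt_eqF.
have t0 : 0 < t by rewrite divr_gt0.
have [HH pE] := @householder_projection R M d v t (etrans (congr1 _ vS) tS).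
exists (1%:M - t *: (v^T *m v)); split=> // p.
pose w := t * s%:R.
have w0 : 0 < w by rewrite mulr_gt0 ?ltr0n.
have w4 : 4 * w < 1.
  have : (8 * s)%:R < S%:R :> R by rewrite ltr_nat.
  by rewrite -(ltr_pM2l t0) tS natrM mulrCA -/w; lra.
(* 4 w < 1 separates the two ranges: 1 - x_a (2 - w) >= 1 - 2 w > 2 w >= w x_b *)
pose x a := t * v 0 a ^+ 2.
have v0 a : 0 < v 0 a by rewrite mxE ltr0n.
have x0 a : 0 < x a by rewrite mulr_gt0 ?exprn_gt0.
have x2 a : x a <= 2.
  by rewrite -tS ler_wpM2l ?(ltW t0) // mxE -natrX ler_nat.
have xw (a : 'I_M) : (a < d)%N -> x a <= w.
  by move=> ad; rewrite ler_wpM2l ?(ltW t0) // mxE -natrX ler_nat u_le_s.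
have pin (a : 'I_M) : (a < d)%N -> p a a = 1 - x a * (2 - w).
  by move=> ad; rewrite pE vs -/w eqxx ad /x /=; ring.
have pout (a : 'I_M) : (a < d)%N = false -> p a a = w * x a.
  by move=> ad; rewrite pE vs -/w eqxx ad /x /=; ring.
have xlt a b : (u a < u b)%N -> x a < x b.
  by move=> uab; rewrite ltr_pM2l // ltrXn2r ?nnegrE ?ltW // !mxE ltr_nat.
split=> [a b ab|a|a b ab].
- rewrite pE vs -/w (negPf ab) /= sub0r oppr_eq0.
  apply: mulf_neq0.
    by apply: mulf_neq0; [apply: mulf_neq0|]; apply: lt0r_neq0.
  by apply/eqP; case: (a < d)%N; case: (b < d)%N => /= h; lra.
- have := x0 a; case ad: (a < d)%N; last by rewrite pout //; nra.
  by rewrite pin //; have := xw _ ad; nra.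
have := ltn_ord b; case ad: (a < d)%N; case bd: (b < d)%N.
- rewrite !pin //; have := @xlt a b; rewrite /u ad bd ltnS => /(_ ab); nra.
- by rewrite (pin _ ad) (pout _ bd); have := xw _ ad; have := x2 b; have := x0 a; have := x0 b; nra.
- by lia.
- rewrite !pout // => bM; have := @xlt b a; rewrite /u ad bd => h.
  have : x b < x a by apply: h; lia.
  nra.
Qed.

(** * Subspaces from unitary matrices *)

Lemma orthproj_unique (R : realType) M (W : {vspace 'rV[R[i]]_M}) x y :
  y \in W -> (forall w, w \in W -> dotmx (x - y) w = 0) -> orthproj W x = y.
Proof.
move=> yW yo; have [pW po] := orthprojP W x.
apply/eqP; rewrite -subr_eq0; apply: contraT => /dotmx_is_dotmx.
have zW : orthproj W x - y \in W by rewrite memvB.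
rewrite [X in dotmx X]( _ : _ = (x - y) - (x - orthproj W x)); last first.
  by rewrite opprB [RHS]addrC addrA subrK.
by rewrite linearBl /= yo // po // subrr ltxx.
Qed.

(** The subspace is the image of the first [d] coordinates under the isometry
    [w |-> w U^*] of row vectors; its orthogonal projection is conjugate to the
    coordinate one. *)
Lemma subspace_of_unitary (R : realType) M d (U : 'M[R[i]]_M) :
  (d <= M)%N -> U *m U^t* = 1%:M ->
  exists W : {vspace 'rV[R[i]]_M}, \dim W = d /\
    forall x, dotmx (orthproj W x) (orthproj W x) =
      (x *m (U *m pid_mx d *m U^t*) *m x^t*) 0 0.
Proof.
move=> dM UU; have UU' := mulmx1C UU.
pose X := [tuple (delta_mx 0 (widen_ord dM i) : 'rV_M) *m U^t* | i < d].
have XE (i : 'I_d) : X`_i = delta_mx 0 (widen_ord dM i) *m U^t*.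
  by rewrite -tnth_nth tnth_mktuple.
have combE (k : 'I_d -> R[i]) : \sum_(i < d) k i *: X`_i
    = (\sum_(i < d) k i *: delta_mx 0 (widen_ord dM i)) *m U^t*.
  by rewrite mulmx_suml; apply: eq_bigr => i _; rewrite XE scalemxAl.
have Xfree : free X.
  apply/freeP => k; rewrite combE => /(congr1 (mulmx^~ U)).
  rewrite mul0mx -mulmxA UU' mulmx1 => /rowP k0 i.
  have := k0 (widen_ord dM i); rewrite summxE (bigD1 i) //= big1 ?addr0.
    by rewrite !mxE !eqxx mulr1.
  move=> j ji; rewrite !mxE eqxx /= (_ : (_ == _) = false) ?mulr0 //.
  by apply/negbTE; rewrite eq_sym; apply: contra ji => /eqP [/val_inj ->].
pose P := U *m pid_mx d *m U^t*.
have PE x : x *m P = \sum_(i < d) (x *m U) 0 (widen_ord dM i) *: X`_i.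
  rewrite combE /P !mulmxA; congr (_ *m _).
  apply/rowP => j; rewrite !mxE summxE.
  case: (ltnP j d) => jd.
    have wj : widen_ord dM (Ordinal jd) = j by apply: val_inj.
    rewrite (bigD1 j) //= (bigD1 (Ordinal jd)) //= !big1 ?addr0.
    - by rewrite wj !mxE !eqxx jd !mulr1.
    - move=> i ij; rewrite !mxE /=; case: eqP => [jw|_]; last by rewrite mulr0.
      by case/eqP: ij; apply: val_inj; rewrite /= jw.
    - move=> i ij; rewrite !mxE; case: eqP => [/val_inj e|_]; last by rewrite mulr0.
      by rewrite e eqxx in ij.
  rewrite !big1 // => i _; rewrite !mxE /=.
    case: eqP => [e|_]; last by rewrite mulr0.
    by move: jd; rewrite e /= leqNgt ltn_ord.
  by case: eqP => [->|_]; rewrite ?ltnNge ?jd mulr0.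
have PT : P^t* = P.
  have UK : U^t*^t* = U by apply/matrixP => i j; rewrite !mxE conjCK.
  by rewrite /P 2!trmx_mul 2!map_mxM UK tr_pid_mx map_pid_mx mulmxA.
have PP : P *m P = P.
  by rewrite /P !mulmxA -(mulmxA _ _ U) UU' mulmx1 -(mulmxA U) mul_pid_mx minnn (minn_idPr _).
have PW x : x *m P \in <<X>>%VS.
  rewrite PE; apply: memv_suml => i _; apply: memvZ; apply: memv_span.
  by rewrite mem_nth ?size_tuple.
have PW' w : w \in <<X>>%VS -> w *m P = w.
  move=> /coord_span ->; rewrite mulmx_suml; apply: eq_bigr => i _.
  rewrite -scalemxAl; congr (_ *: _); rewrite XE /P -!mulmxA (mulmxA _ U) UU' mul1mx mulmxA.
  congr (_ *m _); apply/rowP => j; rewrite !mxE (bigD1 (widen_ord dM i)) //= big1 ?addr0.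
    by rewrite !mxE !eqxx /= ltn_ord andbT mul1r; congr (nat_of_bool _)%:R; exact: eq_sym.
  by move=> k ki; rewrite !mxE (negPf ki) mul0r.
exists <<X>>%VS; split; first by rewrite (eqP Xfree) size_tuple.
move=> x; rewrite (@orthproj_unique _ _ _ x (x *m P)) //.
  by rewrite dotmxE trmx_mul map_mxM PT mulmxA -(mulmxA x P P) PP.
move=> w /PW' <-; rewrite dotmxE trmx_mul map_mxM PT mulmxA mulmxBl -mulmxA PP.
by rewrite subrr mul0mx mxE.
Qed.

(** Conjugation by a diagonal unitary matrix with entries [z ^ (2 ^ a)]. The map [s] also
    permutes the coordinates, so that one real projection provides both a
    decreasing and an increasing diagonal. *)
Lemma twisted_projection (R : realType) (M d : nat) (H : 'M[R]_M)
    (s : 'I_M -> 'I_M) (z : R[i]) :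
  z != 0 -> (z^*)%R = z^-1 -> injective s -> H *m H^T = 1%:M ->
  let U := \matrix_(a, c) (z ^+ (2 ^ a) * (H (s a) c)%:C) in
  U *m U^t* = 1%:M /\
  forall a b, (U *m pid_mx d *m U^t*) a b =
    z ^+ (2 ^ a) * z^-1 ^+ (2 ^ b) * ((H *m pid_mx d *m H^T) (s a) (s b))%:C.
Proof.
move=> z0 zJ s_inj HH U.
have conjR (x : R) : ((x%:C)^*)%R = x%:C by exact: conjc_real.
have UE (T : 'M[R]_M) a b : (U *m map_mx (real_complex R) T *m U^t*) a b =
    z ^+ (2 ^ a) * z^-1 ^+ (2 ^ b) * ((H *m T *m H^T) (s a) (s b))%:C.
  have -> : U *m map_mx (real_complex R) T =
      \matrix_(a, c) (z ^+ (2 ^ a) * ((H *m T) (s a) c)%:C).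
    apply/matrixP => i j; rewrite !mxE rmorph_sum mulr_sumr /=.
    by apply: eq_bigr => c _; rewrite !mxE rmorphM mulrA.
  rewrite !mxE rmorph_sum mulr_sumr; apply: eq_bigr => c _.
  rewrite !mxE !rmorphM rmorphXn /= conjR zJ; ring.
split=> [|a b]; last by rewrite -UE map_pid_mx.
apply/matrixP => a b; rewrite -[X in X *m _]mulmx1 -(map_mx1 (real_complex R)) UE.
rewrite mulmx1 HH !mxE (inj_eq s_inj); case: eqP => [->|_]; last by rewrite mulr0.
by rewrite mulr1 exprVn divff // expf_neq0.
Qed.

(** * Laurent polynomials on the unit circle *)

(** A difference of two distinct powers of two determines both: its 2-adic
    valuation is the smaller exponent. *)
Lemma pow2_sum_inj a b c e : a != b ->
  (2 ^ a + 2 ^ e = 2 ^ c + 2 ^ b)%N -> a = c /\ e = b.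
Proof.
have log2 m k : (k < m)%N -> logn 2 (2 ^ m - 2 ^ k) = k.
  move=> km; rewrite (_ : 2 ^ m - 2 ^ k = 2 ^ k * (2 ^ (m - k) - 1))%N; last first.
    by rewrite mulnBr muln1 -expnD subnKC // ltnW.
  have mk : (0 < m - k)%N by rewrite subn_gt0.
  have odd2 : odd (2 ^ (m - k) - 1) by rewrite oddB ?expn_gt0 // oddX eqn0Ngt mk.
  rewrite lognM ?expn_gt0 ?(odd_gt0 odd2) // pfactorK // logn_coprime ?addn0 //.
  by rewrite coprime2n.
move=> + H; wlog ab : a b c e H / (b < a)%N => [hw|_].
  rewrite neq_ltn => /orP[ab|ab]; last by apply: hw; rewrite // gtn_eqF.
  have [||-> ->] // := hw b a e c _ ab; first lia.
  by rewrite gtn_eqF.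
have h1 : (2 ^ a - 2 ^ b = 2 ^ c - 2 ^ e)%N by lia.
have h2 : (2 ^ b < 2 ^ a)%N by rewrite ltn_exp2l.
have ec : (e < c)%N by rewrite -(@ltn_exp2l 2) //; lia.
have be : b = e by rewrite -(log2 a b) // h1 log2.
split=> //; apply/eqP; rewrite -(eqn_exp2l _ _ (_ : 1 < 2)%N) //; apply/eqP.
by subst e; lia.
Qed.

(** The off-diagonal coefficient [w a b] is alone in its degree [2 ^ a - 2 ^ b], so
    it keeps the Laurent polynomial from being zero; multiplying by
    [z ^ (2 ^ M)] makes it a polynomial of degree at most [2 * 2 ^ M]. *)
Lemma laurent_zeros (F : fieldType) M (w : 'M[F]_M) a b (zs : seq F) :
  a != b -> w a b != 0 -> uniq zs ->
  all (fun z => (z != 0) &&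
    (\sum_(c < M) \sum_(d < M) z ^+ (2 ^ c) * z^-1 ^+ (2 ^ d) * w c d == 0)) zs ->
  (size zs <= 2 ^ M + 2 ^ M)%N.
Proof.
move=> ab wab zs_uniq zsP.
have le2 (c : 'I_M) : (2 ^ c <= 2 ^ M)%N by rewrite leq_pexp2l // ltnW.
pose g : {poly F} := \sum_c \sum_d (w c d)%:P * 'X^(2 ^ M - 2 ^ d + 2 ^ c).
have g0 : g != 0.
  apply: contra_neq wab => gz; have := coef0 F (2 ^ M - 2 ^ b + 2 ^ a).
  rewrite -gz coef_sum (bigD1 a) //= coef_sum (bigD1 b) //= coefCM coefXn eqxx mulr1.
  have other c d : (c, d) != (a, b) ->
      ((w c d)%:P * 'X^(2 ^ M - 2 ^ d + 2 ^ c))`_(2 ^ M - 2 ^ b + 2 ^ a) = 0.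
    move=> cd; rewrite coefCM coefXn; case: eqP; rewrite ?mulr0 // => h.
    have [|/val_inj ac /val_inj bd] := @pow2_sum_inj a b c d ab.
      by have := le2 b; have := le2 d; lia.
    by rewrite ac bd eqxx in cd.
  rewrite [X in _ + X + _]big1 ?addr0 => [|d db]; last first.
    by apply: other; rewrite xpair_eqE (negPf db) andbF.
  rewrite [X in _ + X]big1 ?addr0 // => c ca.
  by rewrite coef_sum big1 // => d _; apply: other; rewrite xpair_eqE (negPf ca).
have gsize : (size g <= (2 ^ M + 2 ^ M).+1)%N.
  apply: (leq_trans (size_sum _ _ _)); apply/bigmax_leqP => c _.
  apply: (leq_trans (size_sum _ _ _)); apply/bigmax_leqP => d _.
  rewrite mul_polyC (leq_trans (size_scale_leq _ _)) // size_polyXn ltnS.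
  by have := le2 c; lia.
rewrite -ltnS (leq_trans _ gsize) // max_poly_roots //.
apply: sub_all zsP => z /andP[z0 /eqP zE]; apply/rootP.
transitivity (z ^+ (2 ^ M) * \sum_(c < M) \sum_(d < M) z ^+ (2 ^ c) * z^-1 ^+ (2 ^ d) * w c d).
  rewrite horner_sum mulr_sumr; apply: eq_bigr => c _.
  rewrite horner_sum mulr_sumr; apply: eq_bigr => d _.
  rewrite hornerM hornerC hornerXn exprD exprB ?unitfE // exprVn.
  by field; rewrite expf_neq0.
by rewrite zE mulr0.
Qed.

Section CirclePoints.
Variable C : numClosedFieldType.

(** The Cayley transform of the integers: infinitely many points of the unit
    circle, given by a rational formula. *)
Definition circle_point (j : nat) : C := (1 + 'i * j%:R) / (1 - 'i * j%:R).

Lemma conj_1i j : (1 + 'i * j%:R : C)^* = 1 - 'i * j%:R.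
Proof. by rewrite rmorphD rmorph1 rmorphM /= conjCi rmorph_nat mulNr. Qed.

Lemma one_addi_neq0 j : (1 + 'i * j%:R : C) != 0.
Proof.
apply/eqP => h; have := congr1 (Num.conj) h; rewrite conj_1i rmorph0 => h'.
have /eqP : (2%:R : C) = 0.
  by rewrite -[RHS](addr0 0) -{1}h -h'; ring.
by rewrite pnatr_eq0.
Qed.

Lemma one_subi_neq0 j : (1 - 'i * j%:R : C) != 0.
Proof. by rewrite -conj_1i conjC_eq0 one_addi_neq0. Qed.

Lemma circle_point_neq0 j : circle_point j != 0.
Proof. by rewrite mulf_neq0 ?invr_eq0 ?one_addi_neq0 ?one_subi_neq0. Qed.

Lemma conj_circle_point j : (circle_point j)^* = (circle_point j)^-1.
Proof.
rewrite fmorph_div /= conj_1i -[X in _ / X^*]conj_1i conjCK.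
by rewrite invf_div.
Qed.

Lemma circle_point_inj : injective circle_point.
Proof.
move=> j k /eqP; rewrite eqr_div ?one_subi_neq0 // => /eqP h.
have : (2 * 'i * j%:R : C) = 2 * 'i * k%:R.
  have h2 : 'i * j%:R - 'i * k%:R = 'i * k%:R - 'i * j%:R :> C.
    apply: (addrI (1 + j%:R * k%:R)).
    have i2 : 'i * 'i = -1 :> C by rewrite -expr2 sqrCi.
    transitivity ((1 + 'i * j%:R : C) * (1 - 'i * k%:R)).
      by rewrite mulrDl mul1r mulrBr mulr1 mulrACA i2; ring.
    by rewrite h mulrDl mul1r mulrBr mulr1 mulrACA i2; ring.
  apply/eqP; rewrite -subr_eq0; apply/eqP.
  transitivity ('i * j%:R - 'i * k%:R - ('i * k%:R - 'i * j%:R) : C); first by ring.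
  by rewrite h2 subrr.
have nz : (2 * 'i : C) != 0 by rewrite mulf_neq0 ?pnatr_eq0 ?neq0Ci.
by move/(mulfI nz)/eqP; rewrite eqr_nat => /eqP.
Qed.
End CirclePoints.

(** * Polarization of a pair of vectors *)

Section Polarization.
Variable C : numClosedFieldType.
Variable M : nat.
Implicit Types x y u v : 'rV[C]_M.

Definition polarization u v : 'M[C]_M :=
  \matrix_(a, b) (u 0 a * (v 0 b)^* + v 0 a * (u 0 b)^*).

(** The ratio is [c = (1 + g) / (1 - g)], whose numerator and denominator are
    conjugate. *)
Lemma skew_ratio_phase x y g : g^* = - g -> x - y = g *: (x + y) ->
  exists c : C, `|c| = 1 /\ x = c *: y.
Proof.
move=> gN xy.
have g1 : 1 - g != 0.
  apply/eqP => h; have g1 : g = 1 by apply/eqP; rewrite eq_sym -subr_eq0 h.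
  have := gN; rewrite g1 rmorph1 => /eqP; rewrite -subr_eq0 opprK.
  by rewrite -(natrD C 1 1) pnatr_eq0.
have conj1g : (1 - g)^* = 1 + g by rewrite rmorphB rmorph1 /= gN opprK.
exists ((1 + g) / (1 - g)); split.
  by rewrite normf_div -conj1g norm_conjC divff ?normr_eq0.
rewrite mulrC -scalerA; apply: (canRL (scalerK g1)).
have h : x = y + (g *: x + g *: y) by rewrite -scalerDr -xy addrC subrK.
by rewrite scalerBl scalerDl !scale1r {1}h -addrA [_ *: x + _]addrC addrK.
Qed.

(** The symmetries of [u v^* + v u^*] are used in turn: rescaling [u] by [1 / u_i] and
    [v] by [u_i^*], subtracting the multiple [g u] with [g] imaginary that makes
    [v_i] real, and dividing [v] by [v_i] when that is possible. The last two
    normalisations leave [u_i = 1] intact. The first alternative is the one in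
    which [v] becomes zero. *)
Lemma normalize_polarization u v : u != 0 ->
  (exists g, g^* = - g /\ v = g *: u) \/
  exists i (b : bool) u' v' k,
    [/\ k != 0, u' 0 i = 1, v' 0 i = b%:R, v' != 0 &
        polarization u' v' = k *: polarization u v].
Proof.
move=> /rV0Pn[i ui].
have ui' : (u 0 i)^* != 0 by rewrite conjC_eq0.
pose u' := (u 0 i)^-1 *: u.
pose c := (u 0 i)^* * v 0 i.
pose g := (c - c^*) / 2.
have gN : g^* = - g.
  by rewrite /g fmorph_div rmorphB /= conjCK rmorph_nat -[RHS]mulNr opprB.
pose v' := (u 0 i)^* *: v - g *: u'.
have u'i : u' 0 i = 1 by rewrite mxE mulVf.
have v'i : v' 0 i = (c + c^*) / 2.
  by rewrite !mxE mulVf // -/c /g; field.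
have conj2 : (2 : C)^* = 2 by rewrite rmorph_nat.
have rr : (v' 0 i)^* = v' 0 i.
  by rewrite v'i fmorph_div rmorphD /= conj2 conjCK addrC.
clearbody g.
have pol : polarization u' v' = polarization u v.
  apply/matrixP => a b; rewrite !mxE !(rmorphB, rmorphM) /= gN ?rmorphM /= fmorphV conjCK.
  by field; rewrite ui ui'.
have [v'0|v'0] := eqVneq v' 0.
  left; exists (g / ((u 0 i) * (u 0 i)^*)); split.
    by rewrite fmorph_div rmorphM /= gN conjCK mulNr [X in - (_ / X)]mulrC.
  move/eqP: v'0; rewrite subr_eq0 => /eqP h.
  rewrite -[LHS](scalerK ui') h !scalerA; congr (_ *: _).
  by field; rewrite ui ui'.
right; exists i; have [r0|r0] := eqVneq (v' 0 i) 0.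
  by exists false, u', v', 1; split; rewrite ?oner_eq0 ?scale1r.
exists true, u', ((v' 0 i)^-1 *: v'), (v' 0 i)^-1; split=> //.
- by rewrite invr_eq0.
- by rewrite mxE mulVf.
- by rewrite scaler_eq0 invr_eq0 negb_or r0.
rewrite -pol; move: (v' 0 i) r0 rr => r r0 rr.
by apply/matrixP => a b; rewrite !mxE rmorphM fmorphV /= rr; ring.
Qed.

(** Row [i] of a diagonal [u v^* + v u^*] gives [v_a = - b u_a] off [i]. So [b = 0] would
    make [v] zero, and for [b = 1] the vanishing of [- 2 u_a u_c^*] leaves at most
    one index [j] other than [i] with [u_j != 0]. Without such a [j], orthogonality
    to [p] reads [p_i = 0]. Otherwise it fixes the ratio [p_i / p_j = |u_j| ^ 2],
    which cannot hold for both [p] and [p']. *)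
Lemma diagonal_polarization u v i (b : bool) (p p' : 'I_M -> C) :
  u 0 i = 1 -> v 0 i = b%:R -> v != 0 ->
  (forall a c, a != c -> polarization u v a c = 0) ->
  (forall a, p a != 0) ->
  (forall a c, a != c -> p a * p' c != p c * p' a) ->
  \sum_a p a * polarization u v a a = 0 ->
  \sum_a p' a * polarization u v a a = 0 -> False.
Proof.
move=> ui vi v0 off pn0 pp'.
have vE a : a != i -> (v 0 a)^* + b%:R * (u 0 a)^* = 0.
  by rewrite eq_sym => /off; rewrite mxE ui vi mul1r.
case: b vi vE => vi vE; last first.
  case/eqP: v0; apply/rowP => a; rewrite [RHS]mxE.
  have [->|/vE] := eqVneq a i; first by rewrite vi.
  by rewrite mul0r addr0 => /eqP; rewrite conjC_eq0 => /eqP.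
have {}vE a : a != i -> v 0 a = - u 0 a.
  move=> /vE /eqP; rewrite mul1r -rmorphD conjC_eq0 addr_eq0 => /eqP //.
have Qi : polarization u v i i = 2.
  by rewrite mxE ui vi /= rmorph1 !mulr1.
have Qa a c : a != i -> c != i -> polarization u v a c = - 2 * (u 0 a * (u 0 c)^*).
  by move=> ai ci; rewrite mxE !vE // rmorphN; ring.
have n2 : (2 : C) != 0 by rewrite pnatr_eq0.
have [/existsP[j /andP[ji uj]]|none] := boolP [exists j, (j != i) && (u 0 j != 0)].
  have sumE (q : 'I_M -> C) : \sum_a q a * polarization u v a a
      = 2 * (q i - q j * (u 0 j * (u 0 j)^*)).
    rewrite (bigD1 i) //= (bigD1 j) //= big1 => [|a /andP[ai aj]].
      by rewrite Qi Qa // addr0; ring.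
    have := off j a; rewrite eq_sym => /(_ aj); rewrite Qa // => /eqP.
    rewrite !mulf_eq0 oppr_eq0 (negPf n2) (negPf uj) conjC_eq0 /= => /eqP ua.
    by rewrite Qa // ua mul0r !mulr0.
  rewrite !sumE => /eqP; rewrite mulf_eq0 (negPf n2) subr_eq0 => /eqP h.
  move=> /eqP; rewrite mulf_eq0 (negPf n2) subr_eq0 => /eqP h'.
  by have /negP[] := pp' _ _ ji; rewrite h h'; apply/eqP; ring.
rewrite (bigD1 i) //= big1 => [|a ai].
  by rewrite Qi addr0 => /eqP; rewrite mulf_eq0 (negPf n2) (negPf (pn0 i)).
move: none; rewrite negb_exists => /forallP/(_ a); rewrite ai negbK => /eqP ua.
by rewrite Qa // ua mul0r !mulr0.
Qed.
End Polarization.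

Definition pairing (C : numClosedFieldType) M (P Q : 'M[C]_M) : C :=
  \sum_a \sum_b P a b * Q a b.

Lemma pairingZr (C : numClosedFieldType) M (P Q : 'M[C]_M) k :
  pairing P (k *: Q) = k * pairing P Q.
Proof.
rewrite mulr_sumr; apply: eq_bigr => a _; rewrite mulr_sumr.
by apply: eq_bigr => b _; rewrite mxE mulrCA.
Qed.

Lemma equal_norms_polarization (C : numClosedFieldType) M (P : 'M[C]_M) (x y : 'rV[C]_M) :
  (x *m P *m x^t*) 0 0 = (y *m P *m y^t*) 0 0 ->
  pairing P (polarization (x + y) (x - y)) = 0.
Proof.
have formE (w : 'rV[C]_M) : (w *m P *m w^t*) 0 0 =
    \sum_a \sum_b P a b * (w 0 a * (w 0 b)^*%R).
  rewrite exchange_big mxE; apply: eq_bigr => b _.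
  rewrite !mxE mulr_suml; apply: eq_bigr => a _; ring.
move=> /eqP; rewrite -subr_eq0 !formE => /eqP h.
rewrite /pairing; transitivity (2 * 0 : C); last exact: mulr0.
rewrite -[in RHS]h -sumrB mulr_sumr; apply: eq_bigr => a _.
rewrite -sumrB mulr_sumr; apply: eq_bigr => b _.
rewrite !mxE rmorphB rmorphD /=; ring.
Qed.

(** If [x] and [y] give equal measurements, then [polarization (x + y) (x - y)] is
    orthogonal to every [P n]. After normalisation it cannot exist, except in the
    degenerate cases [x + y = 0] and [x - y = g (x + y)] with [g] imaginary,
    where [x] and [y] differ by a phase. *)
Lemma phase_retrieval_criterion (C : numClosedFieldType) M N
    (P : 'I_N -> 'M[C]_M) :
  (forall i (b : bool) (u v : 'rV_M), u 0 i = 1 -> v 0 i = b%:R -> v != 0 ->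
     exists n, pairing (P n) (polarization u v) != 0) ->
  forall x y : 'rV_M,
    (forall n, (x *m P n *m x^t*) 0 0 = (y *m P n *m y^t*) 0 0) ->
    exists c : C, `|c| = 1 /\ x = c *: y.
Proof.
move=> hP x y norms; have [xy0|xy0] := eqVneq (x + y) 0.
  exists (-1); rewrite normrN1; split=> //.
  by rewrite scaleN1r; apply/eqP; rewrite -addr_eq0 xy0.
have [[g [gN gE]]|[i [b [u [v [k [k0 ui vi v0 pol]]]]]]] :=
    normalize_polarization (x - y) xy0.
  exact: skew_ratio_phase gN gE.
have [n] := hP i b u v ui vi v0.
by rewrite pol pairingZr equal_norms_polarization ?mulr0 ?eqxx.
Qed.

Section Coordinates.
Variables (C : numClosedFieldType) (m : nat) (i : 'I_m.+1).
Local Notation L := ('I_m * (bool * bool))%type.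

(** A normalised pair [(u, v)] is encoded by a point with four coordinates for each
    index other than [i], namely the entries of [u], [u^*], [v] and [v^*] there.
    The first boolean selects [v] and the second one conjugation. Treating
    conjugates as separate variables makes the entries of the polarization
    polynomial. The entry at [i] is the constant [c]. *)
Definition affine_entry (c : C) (w : bool * bool) (a : 'I_m.+1) (q : L -> C) : C :=
  if unlift i a is Some a' then q (a', w) else c.

Definition affine_coords (u v : 'rV[C]_m.+1) (l : L) : C :=
  let x := (if l.2.1 then v else u) 0 (lift i l.1) in
  if l.2.2 then (x^*)%R else x.

Definition polarization_entry (b : bool) (a c : 'I_m.+1) (q : L -> C) : C :=
  affine_entry 1 (false, false) a q * affine_entry b%:R (true, true) c q +
  affine_entry b%:R (true, false) a q * affine_entry 1 (false, true) c q.

Lemma multideg_le_polarization_entry b a c : multideg_le 2 (polarization_entry b a c).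
Proof.
have h c' w a' : multideg_le 1 (affine_entry c' w a').
  by rewrite /affine_entry; case: (unlift i a') => [a''|];
    [exact: multideg_le_var | exact: multideg_le_const].
by apply: multideg_leD; apply: (@multideg_leM _ _ 1 1).
Qed.

Lemma polarization_entryE (b : bool) (u v : 'rV[C]_m.+1) a c :
  u 0 i = 1 -> v 0 i = b%:R ->
  polarization_entry b a c (affine_coords u v) = polarization u v a c.
Proof.
move=> ui vi; rewrite mxE /polarization_entry /affine_entry /affine_coords.
by case: (unliftP i a) => [a'|] ->; case: (unliftP i c) => [c'|] -> /=;
  rewrite ?ui ?vi ?rmorph1 ?rmorph_nat.
Qed.
End Coordinates.

(** * Phase retrieval *)

Theorem corollary2p7 (R : realType) (M : nat) (M_gt0 : (0 < M)%N)
    (d : 'I_(4 * M - 3) -> nat)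
    (d_bound : forall n : 'I_(4 * M - 3), (1 <= d n < M)%N) :
  exists W : 'I_(4 * M - 3) -> {vspace 'rV[R[i]]_M},
    (forall n : 'I_(4 * M - 3), \dim (W n) = d n) /\
    allows_phase_retrieval W.
Proof.
case: M => [//|m] in M_gt0 d d_bound *.
have N0 : (0 < 4 * m.+1 - 3)%N by lia.
have m0 : (0 < m)%N by have := d_bound (Ordinal N0); lia.
have N1 : (1 < 4 * m.+1 - 3)%N by lia.
have /fin_all_exists[H HP] n := exists_decreasing_projection R (d_bound n).
pose p n := H n *m pid_mx (d n) *m (H n)^T.
(* decreasing diagonal for the first subspace, increasing for the others *)
pose s (n : 'I_(4 * m.+1 - 3)) (a : 'I_m.+1) :=
  if n == 0%N :> nat then a else rev_ord a.
have s_inj n : injective (s n).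
  by move=> a c; rewrite /s; case: (n == 0%N :> nat) => //; apply: rev_ord_inj.
pose z j : R[i] := circle_point _ j.
pose U n j : 'M[R[i]]_m.+1 := \matrix_(a, c) (z j ^+ (2 ^ a) * (H n (s n a) c)%:C).
pose P n j := U n j *m pid_mx (d n) *m (U n j)^t*.
have UP n j : U n j *m (U n j)^t* = 1%:M /\ forall a b, P n j a b =
    z j ^+ (2 ^ a) * (z j)^-1 ^+ (2 ^ b) * (p n (s n a) (s n b))%:C.
  apply: twisted_projection.
  - exact: circle_point_neq0.
  - exact: conj_circle_point.
  - exact: s_inj.
  - exact: (HP n).1.
pose f (t : 'I_m.+1 * bool) n j q :=
  \sum_a \sum_b P n j a b * polarization_entry t.1 t.2 a b q.
pose X (t : 'I_m.+1 * bool) q := exists u v : 'rV[R[i]]_m.+1,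
  [/\ u 0 t.1 = 1, v 0 t.1 = t.2%:R, q = affine_coords t.1 u v &
      exists a c, a != c /\ polarization u v a c != 0].
have fE (t : 'I_m.+1 * bool) n j (u v : 'rV_m.+1) :
    u 0 t.1 = 1 -> v 0 t.1 = t.2%:R ->
    f t n j (affine_coords t.1 u v) = pairing (P n j) (polarization u v).
  move=> ut vt; apply: eq_bigr => a _; apply: eq_bigr => b _.
  by rewrite polarization_entryE.
have [|t n j|t q n js [u [v [ut vt -> [a [c [ac Qac]]]]]] js_uniq fjs|tau tauP] :=
    @exists_transversal R[i] _ _ (4 * m.+1 - 3) 2 (2 ^ m.+1 + 2 ^ m.+1) f X.
- by rewrite !card_prod card_ord card_bool; lia.
- apply: multideg_le_sum => a; apply: multideg_le_sum => b; apply: multideg_leZ.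
  exact: multideg_le_polarization_entry.
- rewrite -(size_map z).
  apply: (@laurent_zeros _ _ (\matrix_(a, b) ((p n (s n a) (s n b))%:C *
            polarization u v a b)) a c) => //.
  + rewrite mxE mulf_neq0 // -(rmorph0 (real_complex R)).
    rewrite (inj_eq (@complexI R)); case: (HP n).2 => + _ _; apply.
    by rewrite (inj_eq (s_inj n)).
  + by rewrite map_inj_uniq //; exact: circle_point_inj.
  apply/allP => _ /mapP[j jjs ->]; rewrite circle_point_neq0 /=.
  apply/eqP; rewrite -[RHS](eqP (allP fjs j jjs)) fE //.
  apply: eq_bigr => a' _; apply: eq_bigr => b' _.
  by rewrite mxE (UP n j).2 mulrA.
have /fin_all_exists[W WP] n :=
  subspace_of_unitary (ltnW (andP (d_bound n)).2) (UP n (tau n)).1.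
exists W; split=> [n|x y xy]; first exact: (WP n).1.
apply: (@phase_retrieval_criterion _ _ _ (fun n => P n (tau n))) => [|n]; last first.
  rewrite -!(WP n).2; have := xy n.
  by rewrite /l2norm => /(congr1 (fun r => r ^+ 2)); rewrite !sqrtCK.
move=> i b u v ui vi v0; apply: contrapT => none.
have {none}orth n : pairing (P n (tau n)) (polarization u v) = 0.
  by apply/eqP; apply: contrapT => /negP nz; apply: none; exists n.
have [/existsP[a /existsP[c /andP[ac Qac]]]|off] :=
    boolP [exists a, exists c, (a != c) && (polarization u v a c != 0)].
  have [|n] := tauP (i, b) (affine_coords i u v).
    by exists u, v; split=> //; exists a, c.
  by rewrite fE // orth eqxx.
have {}off a c : a != c -> polarization u v a c = 0.
  move=> ac; apply/eqP; move: off; rewrite negb_exists => /forallP/(_ a).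
  by rewrite negb_exists => /forallP/(_ c); rewrite ac negbK.
have diag n : \sum_a (p n (s n a) (s n a))%:C * polarization u v a a = 0.
  rewrite -[RHS](orth n); apply: eq_bigr => a _.
  rewrite (bigD1 a) //= big1 ?addr0 => [|c ca].
    by rewrite (UP _ _).2 exprVn divff ?mul1r // expf_neq0 // circle_point_neq0.
  by rewrite off ?mulr0 // eq_sym.
case: (diagonal_polarization ui vi v0 off _ _
         (diag (Ordinal N0)) (diag (Ordinal N1))).
  move=> a; rewrite -(rmorph0 (real_complex R)) (inj_eq (@complexI R)) lt0r_neq0 //.
  by case: (HP (Ordinal N0)).2.
have [_ pos0 dec0] := (HP (Ordinal N0)).2; have [_ pos1 dec1] := (HP (Ordinal N1)).2.
have lt (a c : 'I_m.+1) : (a < c)%N ->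
    p (Ordinal N0) c c * p (Ordinal N1) (rev_ord a) (rev_ord a) <
    p (Ordinal N0) a a * p (Ordinal N1) (rev_ord c) (rev_ord c).
  move=> ac; apply: ltr_pM; rewrite ?ltW ?pos0 ?pos1 ?dec0 //.
  by apply: dec1; rewrite /=; have := ltn_ord c; lia.
move=> a c ac; rewrite -!rmorphM (inj_eq (@complexI R)) /s /=.
have := ac; rewrite neq_ltn => /orP[/lt h|/lt h]; first by rewrite gt_eqF.
by rewrite lt_eqF.
Qed.
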